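(* Let $n$ be a friend of $10$, and let $q_2$ be the second smallest prime divisor of $n$ (the prime divisors of $n$ being listed without multiplicity in increasing order). Then $$7\leq q_2 < \left\lceil\frac{7\omega(n)}{3}\right\rceil\left\{\log\left(\left\lceil\frac{7\omega(n)}{3}\right\rceil\right)+2\log\log\left(\left\lceil\frac{7\omega(n)}{3}\right\rceil\right)\right\}.$$
   Context: For a positive integer $n$, let $\sigma(n)$ be the sum of the positive divisors of $n$ and let $I(n)=\sigma(n)/n$ be its abundancy index. A friend of $10$ is a positive integer $n\neq 10$ with $I(n)=I(10)=9/5$. $\omega(n)$ denotes the number of distinct prime divisors of $n$, $\lceil\cdot\rceil$ is the ceiling function, and $\log$ is the natural logarithm. The braces in the displayed bound are ordinary grouping brackets (not the fractional part). *)

(* Defs.v *)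
From mathcomp Require Import all_boot all_order all_algebra.
From mathcomp Require Import reals exp.

Set Implicit Arguments.
Unset Strict Implicit.
Unset Printing Implicit Defensive.

Import Order.TTheory GRing.Theory Num.Theory.

Definition sigma (n : nat) : nat := (\sum_(d <- divisors n) d)%N.

Definition abundancy (n : nat) : rat := ((sigma n)%:R / n%:R)%R.

Definition is_friend_of (m n : nat) : Prop :=
  [/\ (0 < n)%N, n <> m & abundancy n = abundancy m].

Definition omega (n : nat) : nat := size (primes n).

(* [primes n] lists the prime divisors without repetition in increasing order.
   The value is 0 when n has fewer than two prime divisors. *)
Definition second_prime_divisor (n : nat) : nat := nth 0%N (primes n) 1.

(* Main.v *)
(** From 5 sigma(n) = 9 n, a friend n of 10 is divisible by 5.  It is odd, since
    I increases strictly under proper multiples and so n is not a multiple of 10;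
    then parity in 5 sigma(n) = 9 n shows that 25 divides n.  If 3 divided n,
    parity would make 9 divide n, and then either 27 divides n, or 9 exactly
    divides n and 13 = sigma(9) divides n: both make I(n) exceed 9/5.  So 5 is
    the least prime divisor of n and q2 >= 7.

    For the upper bound, I(n) < prod p/(p-1) over the primes p of n.  Bounding
    the i-th prime from below by q2 + (i-2) for i >= 2, the product telescopes
    and gives 9/5 <= 5/4 * (q2 + w - 2)/(q2 - 1) with w = omega(n), that is
    11 q2 <= 25 w - 14, so q2 < 7w/3 <= N.  Finally N > 4 > e, so that the
    factor ln N + 2 ln (ln N) exceeds 1. *)
Require Import Defs.
From mathcomp Require Import all_boot all_order all_algebra.
From mathcomp Require Import reals sequences exp.
From mathcomp Require Import zify lra.

Set Implicit Arguments.
Unset Strict Implicit.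
Unset Printing Implicit Defensive.

Import Order.TTheory GRing.Theory Num.Theory.

(** * Multiplicativity and bounds for the sum of divisors *)

Section Sigma.
Local Open Scope nat_scope.

(** Multiplying pairs of divisors is injective because the gcd of [a * b] with [m] recovers [a]; it
    is onto by splitting [d] into its gcds with [m] and [n]. *)
Lemma sigmaM m n : 0 < m -> 0 < n -> coprime m n ->
  sigma (m * n) = sigma m * sigma n.
Proof.
move=> m0 n0 co_mn; rewrite /sigma big_distrlr /=.
pose mulp (u : nat * nat) := u.1 * u.2.
rewrite -[RHS](big_allpairs (F := mulp)).
rewrite -(big_map mulp xpredT id); apply: perm_big; apply: uniq_perm.
- exact: divisors_uniq.
- rewrite map_inj_in_uniq.
    by apply: allpairs_uniq; rewrite ?divisors_uniq // => -[? ?] [? ?].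
  have gcdE a b : a %| m -> b %| n -> gcdn (a * b) m = a.
    move=> am bn; have /eqP co_mb : coprime m b by apply: coprime_dvdr bn co_mn.
    by rewrite gcdnC Gauss_gcdl ?/coprime ?co_mb //; apply/gcdn_idPr.
  move=> _ _ /allpairsP[[a b] /= [ad bd ->]] /allpairsP[[c d] /= [cd dd ->]].
  move: ad bd cd dd; rewrite -!dvdn_divisors // /mulp /= => am bn cm dn E.
  have ac : a = c by rewrite -(gcdE a b) // -(gcdE c d) // E.
  move: E; rewrite -ac => /eqP.
  by rewrite eqn_pmul2l ?(dvdn_gt0 m0) // => /eqP ->.
- move=> d; rewrite -dvdn_divisors ?muln_gt0 ?m0 //; apply/idP/mapP.
  + move=> dmn; exists (gcdn d m, gcdn d n).
      by apply/allpairsP; exists (gcdn d m, gcdn d n);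
         rewrite -!dvdn_divisors // !dvdn_gcdr.
    apply/eqP; rewrite eqn_dvd /mulp /=; apply/andP; split.
      rewrite muln_gcdl !muln_gcdr !dvdn_gcd dmn.
      by rewrite (dvdn_mull m) ?dvdnn ?(dvdn_mulr _ (dvdnn d)).
    rewrite Gauss_dvd ?dvdn_gcdl //.
    by apply: coprime_dvdl (dvdn_gcdr d m) (coprime_dvdr (dvdn_gcdr d n) co_mn).
  + case=> _ /allpairsP[[a b] /= [ad bd ->]] ->.
    by move: ad bd; rewrite -!dvdn_divisors // => am bn; apply: dvdn_mul.
Qed.

(* The divisor 1 is not of the form [k * d] when [1 < k]. *)
Lemma leq_sigmaMl k m : 0 < k -> 0 < m -> k * sigma m + (1 < k) <= sigma (k * m).
Proof.
move=> k0 m0; rewrite /sigma big_distrr /= -(big_map (muln k) xpredT id) /=.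
have inj_k : injective (muln k).
  by move=> a b /eqP; rewrite eqn_pmul2l // => /eqP.
have sub d : d \in map (muln k) (divisors m) -> d \in divisors (k * m).
  case/mapP=> e; rewrite -!dvdn_divisors ?muln_gt0 ?k0 // => em ->.
  exact: dvdn_mul.
have uniq_k : uniq (map (muln k) (divisors m)).
  by rewrite map_inj_uniq ?divisors_uniq.
have [k1|_] := boolP (1 < k); last first.
  rewrite addn0; apply: (uniq_sub_le_big leqnn (fun x y => leq_addr y x)) => //.
  exact: divisors_uniq.
rewrite addnC -(big_cons _ _ 1 _ xpredT id).
apply: (uniq_sub_le_big leqnn (fun x y => leq_addr y x)).
- rewrite /= uniq_k andbT; apply/mapP => -[d _ /esym/eqP].
  by rewrite muln_eq1 => /andP[/eqP k_1]; rewrite k_1 in k1.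
- exact: divisors_uniq.
- by move=> d; rewrite inE => /predU1P[->|/sub //]; apply: divisor1.
Qed.

Lemma sigma_pfactor p a : prime p -> sigma (p ^ a) = \sum_(i < a.+1) p ^ i.
Proof.
move=> p_pr; rewrite /sigma -(big_mkord xpredT (expn p)).
rewrite -(big_map (expn p) xpredT id); apply: perm_big.
apply: uniq_perm; first exact: divisors_uniq.
  by rewrite map_inj_uniq ?iota_uniq //; apply/expnI/prime_gt1.
move=> d; rewrite -dvdn_divisors ?expn_gt0 ?prime_gt0 //.
apply/(dvdn_pfactor _ _ p_pr)/mapP => -[i].
  by exists i; rewrite // mem_index_iota.
by rewrite mem_index_iota => ? ->; exists i.
Qed.

(** By the geometric sum, [I(p ^ a) < p / (p - 1)], here cleared of denominators. *)
Lemma sigma_pfactor_lt p a : prime p -> sigma (p ^ a) * p.-1 < p ^ a * p.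
Proof.
move=> p_pr; rewrite sigma_pfactor // mulnC -predn_exp -expnSr prednK //.
by rewrite expn_gt0 prime_gt0.
Qed.

Lemma primes_consP n p s : primes n = p :: s ->
  exists a m, [/\ n = p ^ a * m, prime p, 0 < m, coprime (p ^ a) m
                & primes m = s].
Proof.
move=> En; have : p \in primes n by rewrite En mem_head.
rewrite mem_primes => /and3P[p_pr n0 pn]; exists (logn p n), n`_p^'.
rewrite -p_part partnC // part_gt0 coprime_partC primes_part En.
split=> //.
have := primes_uniq n; rewrite En /= !inE eqxx /= => /andP[ps _].
by apply/all_filterP/allP => q qs; rewrite !inE; apply: contraNneq ps => <-.
Qed.

(* [prod_(q | n) q/(q-1)] is at most the telescoping product of [(p+i)/(p+i-1)]. *)
Lemma sigma_primes_le n p s : primes n = p :: s ->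
  sigma n * p.-1 <= n * (p + size s).
Proof.
elim: s n p => [|q s IHs] n p /[dup] En /primes_consP[a [m [-> p_pr m0 co_m Em]]];
  rewrite sigmaM ?m0 ?expn_gt0 ?prime_gt0 //; have := sigma_pfactor_lt a p_pr.
  have -> : m = 1.
    by apply/eqP; move/eqP: Em; rewrite primes_eq0; lia.
  have -> : sigma 1 = 1 by rewrite /sigma unlock.
  by rewrite /= !muln1 addn0; apply: ltnW.
have pq : p < q.
  by have := sorted_primes n; rewrite En /= => /andP[].
have p0 := prime_gt0 p_pr; move=> /ltnW le_p; have le_m := IHs _ _ Em.
(* Since [(x + c) / (x - 1)] decreases in [x] and [q >= p + 1], [q] may be replaced by [p + 1]; the
   new denominator [p] cancels the numerator in [le_p]. *)
have {}le_m : sigma m * p <= m * (p + (size s).+1).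
  have q0 : 0 < q.-1 by lia.
  rewrite -(leq_pmul2r q0) mulnAC; apply: (leq_trans (leq_mul le_m (leqnn p))).
  rewrite -!mulnA leq_mul2l; apply/orP; right; nia.
rewrite -(leq_pmul2r p0) /=; have := leq_mul le_p le_m.
set A := sigma (_ ^ _); set B := p ^ _; set C := sigma m; set D := _.+1.
by move=> H; rewrite [X in X <= _](_ : _ = A * p.-1 * (C * p)); [apply: leq_trans H _|]; lia.
Qed.

End Sigma.

(** * Prime divisors of a friend of 10 *)

Section FriendsOfTen.
Local Open Scope nat_scope.
Variable n : nat.
Hypothesis n_friend : is_friend_of 10 n.

Let n_gt0 : 0 < n. Proof. by case: n_friend. Qed.

Lemma friend10_sigma : 5 * sigma n = 9 * n.
Proof.
case: n_friend => n0 _; rewrite /abundancy.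
have -> : sigma 10 = 18 by rewrite /sigma unlock.
move/eqP; rewrite GRing.eqr_div ?Num.Theory.pnatr_eq0 -?lt0n //.
by rewrite -!GRing.natrM Num.Theory.eqr_nat => /eqP; lia.
Qed.

Lemma friend10_dvd5 : 5 %| n.
Proof. by rewrite -(@Gauss_dvdr 5 9) // -friend10_sigma dvdn_mulr. Qed.

Lemma friend10_odd : odd n.
Proof.
case: n_friend => n0 n10 _; rewrite -[odd n]negbK -dvdn2; apply/negP => n2.
have /dvdnP[k nk] : 10 %| n by rewrite (@Gauss_dvd 2 5) // n2 friend10_dvd5.
have k1 : 1 < k by lia.
have := @leq_sigmaMl k 10 (ltnW k1) isT; have := friend10_sigma.
have -> : sigma 10 = 18 by rewrite /sigma unlock.
by rewrite nk k1; lia.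
Qed.

(* If [p ^ a] exactly divides [n] and [sigma (p ^ a)] is even, then so is [9 n]. *)
Lemma friend10_odd_sigma_logn p : prime p -> odd (sigma (p ^ logn p n)).
Proof.
move=> p_pr; have [m co_m En] := pfactor_coprime p_pr n_gt0.
have m0 : 0 < m by have := n_gt0; rewrite {1}En muln_gt0 => /andP[].
have := congr1 odd friend10_sigma; rewrite !oddM friend10_odd {1}En.
rewrite sigmaM ?m0 ?expn_gt0 ?prime_gt0 // 1?coprime_sym ?coprimeXl // oddM.
by rewrite /= => /andP[].
Qed.

Lemma friend10_dvd25 : 25 %| n.
Proof.
have := friend10_odd_sigma_logn (isT : prime 5).
rewrite -[25]/(5 ^ 2) pfactor_dvdn //.
have := friend10_dvd5; rewrite -[X in X %| _]/(5 ^ 1) pfactor_dvdn //.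
(* Exponent 1 is impossible because [sigma 5 = 6] is even. *)
by case: logn => [|[|a]] // _; rewrite /sigma unlock.
Qed.

Lemma friend10_ndvd3 : ~~ (3 %| n).
Proof.
(* A divisor [d] with [I(d) > 9/5] would force [I(n) > 9/5]. *)
have not_dvd d : 0 < d -> 9 * d < 5 * sigma d -> d %| n -> False.
  move=> d0 lt_d /dvdnP[k nk]; have := n_gt0; rewrite nk muln_gt0 d0 andbT => k0.
  have := leq_sigmaMl k0 d0; have := friend10_sigma; rewrite nk.
  by move: (k <= 1); nia.
have s9 : sigma 9 = 13 by rewrite /sigma unlock.
have s13 : sigma 13 = 14 by rewrite /sigma unlock.
have s25 : sigma 25 = 31 by rewrite /sigma unlock.
have s27 : sigma 27 = 40 by rewrite /sigma unlock.
have n25 := friend10_dvd25.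
apply/negP; rewrite -[3]/(3 ^ 1) pfactor_dvdn // => le1.
have := friend10_odd_sigma_logn (isT : prime 3).
have [n27|] := boolP (3 ^ 3 %| n).
  case: (not_dvd (27 * 25)) => //; last by rewrite Gauss_dvd // n27.
  by rewrite sigmaM // s25 s27.
have [m co_m En] := pfactor_coprime (isT : prime 3) n_gt0.
(* The exponent of 3 is now 1 or 2, and 1 fails because [sigma 3 = 4] is even. *)
rewrite pfactor_dvdn //; case Ea: (logn 3 n) le1 => [|[|[|a]]] //= _ _.
  by rewrite /sigma unlock.
rewrite Ea -[3 ^ 2]/9 in En *; move=> _.
have m0 : 0 < m by have := n_gt0; rewrite En muln_gt0 => /andP[].
have co_m9 : coprime m 9 by rewrite coprime_sym (@coprime_pexpl 2 3).
have E9 : 5 * 13 * sigma m = 81 * m.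
  have := friend10_sigma; rewrite En (sigmaM m0 _ co_m9) // s9; lia.
have m13 : 13 %| m.
  by rewrite -(@Gauss_dvdr 13 81) // -E9 -mulnA mulnCA dvdn_mulr.
case: (not_dvd (9 * 25 * 13)) => //.
  by rewrite !sigmaM // s9 s13 s25.
by rewrite !Gauss_dvd // n25 andbT En dvdn_mull //= dvdn_mulr.
Qed.

Lemma friend10_primes : exists q s, primes n = [:: 5, q & s].
Proof.
have : 5 \in primes n by rewrite mem_primes n_gt0 friend10_dvd5.
(* The composite 4 is listed so that a prime outside the list is at least 5. *)
have: {subset primes n <= [predC [:: 2; 3; 4]]}.
  move=> p; rewrite mem_primes !inE => /and3P[p_pr _ pn]; apply/negP.
  case/or3P=> /eqP pE; rewrite pE // in p_pr pn.
    by rewrite dvdn2 friend10_odd in pn.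
  by rewrite (negPf friend10_ndvd3) in pn.
have := sorted_primes n; have : all prime (primes n).
  by apply/allP => p; rewrite mem_primes => /andP[].
case En: (primes n) => [|p s] //= /andP[p_pr _] path_s sub5 p5.
have p_5 : p = 5.
  have := sub5 p (mem_head _ _); rewrite !inE.
  have := prime_gt1 p_pr; move: p5; rewrite inE => /predU1P[//|].
  by move/(allP (order_path_min ltn_trans path_s)) => /=; lia.
rewrite p_5 in En *; case: s En {sub5 p5 path_s} => [|q s] En; last by exists q, s.
(* A power of 5 would have [I(n) <= 5/4 < 9/5]. *)
have := sigma_primes_le En; have := friend10_sigma; have := n_gt0.
by rewrite /=; lia.
Qed.

Lemma friend10_second_prime_bounds :
  [/\ 7 <= second_prime_divisor n, 1 < omega n
    & 11 * second_prime_divisor n + 14 <= 25 * omega n].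
Proof.
have [q [s En]] := friend10_primes.
rewrite /second_prime_divisor /omega En /=.
have q_ge7 : 7 <= q.
  have q_pr : prime q.
    have : q \in primes n by rewrite En !inE eqxx orbT.
    by rewrite mem_primes => /andP[].
  have := sorted_primes n; rewrite En /= => /andP[q5 _].
  have : q != 6 by apply: contraTneq q_pr => ->.
  by lia.
split=> //.
(* Detaching the power of 5 lets the telescoping start at [q] instead of 5, which keeps [q] in the
   bound. *)
have [a [m [Enm _ m0 co_m Em]]] := primes_consP En.
have := friend10_sigma; rewrite Enm sigmaM ?expn_gt0 //.
have := sigma_pfactor_lt a (isT : prime 5); have := sigma_primes_le Em.
have : 0 < 5 ^ a * m by rewrite muln_gt0 expn_gt0.
move: (5 ^ a) (sigma (5 ^ a)) (sigma m) => B A C /= Bm0 le_m /ltnW le_5 E.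
have H : 4 * (A * C) * q.-1 <= 5 * (B * m) * (q + size s).
  by have := leq_mul le_5 le_m; lia.
move: (A * C) (B * m) E Bm0 H => X Y E Y0 H.
have : Y * (36 * q.-1) <= Y * (25 * (q + size s)) by nia.
by rewrite leq_pmul2l //; lia.
Qed.

End FriendsOfTen.

(** * Logarithmic estimates and conclusion *)

Local Open Scope ring_scope.

(** From [1 + x <= expR x] at [x = -1/2], the square root of e is at most 2. *)
Lemma expR1_le4 (R : realType) : expR 1 <= 4 :> R.
Proof.
have half : 1 / 2 <= (expR (1 / 2))^-1 :> R.
  by rewrite -expRN; apply: le_trans (expR_ge1Dx _); lra.
have -> : 1 = 1 / 2 + 1 / 2 :> R by lra.
have e0 := expR_gt0 (1 / 2 : R).
have : expR (1 / 2) <= 2 :> R.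
  by have := mulfV (lt0r_neq0 e0); nra.
by rewrite expRD; nra.
Qed.

Lemma lt_mul_lnDlnln (R : realType) (x : R) : 4 < x -> x < x * (ln x + 2 * ln (ln x)).
Proof.
move=> x4; have x0 : 0 < x by lra.
have ln1 : 1 < ln x.
  by rewrite -ltr_expR lnK ?posrE //; apply: le_lt_trans x4; apply: expR1_le4.
by have := ln_gt0 ln1; nra.
Qed.

Theorem theorem1p1 (R : realType) (n : nat) (hn : is_friend_of 10 n) :
  let q2 := second_prime_divisor n in
  let N : R := (Num.ceil (7 * (omega n)%:R / 3 : R))%:~R in
  (7 <= q2)%N /\ q2%:R < N * (ln N + 2 * ln (ln N)).
Proof.
move=> q2 N; have [q_ge7 w_gt1 q_le] := friend10_second_prime_bounds hn.
split=> //.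
have le_N : 7 * (omega n)%:R / 3 <= N by apply: ceil_ge.
have w2 : 2 <= (omega n)%:R :> R by rewrite ler_nat.
have q2_le : 11 * q2%:R + 14 <= 25 * (omega n)%:R :> R.
  by rewrite -!natrM -natrD ler_nat.
(* Here [q2 < N] because [25/11 < 7/3], and [4 < N] because [omega n >= 2] gives [N >= 14/3]. *)
by have := @lt_mul_lnDlnln R N; lra.
Qed.
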